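(* Let $G$ be a finite abelian group of order $h$, written additively, and let $S = (r_1^{e_1}, r_2^{e_2}, \dots, r_g^{e_g})$ be a sequence in $G$, where each $r_i$ is an element of $G$ with multiplicity $e_i$. The number $n(S)$ of zero-sum subsequences of $S$ is given by $$n(S) = \frac{1}{h} \sum_{\chi \in \hat{G}} \prod_{i=1}^{g} \left( \sum_{k=0}^{e_i} \chi(r_i)^k \right),$$ where $\hat{G}$ is the dual group of characters of $G$.
   Context: $\hat{G}$ is the group of all group homomorphisms $\chi : G \to \mathbb{C}^*$. The notation $S = (r_1^{e_1}, \dots, r_g^{e_g})$ means the sequence in which $r_i$ is repeated $e_i$ times ($e_i$ a non-negative integer). Subsequences of $S$ are represented by (and counted as) tuples of exponents $(f_1, \dots, f_g)$ of integers with $0 \le f_i \le e_i$ for all $i$; the subsequence is zero-sum if $\sum_{i=1}^{g} f_i r_i = 0_G$, where $0_G$ is the identity of $G$. The empty subsequence (all $f_i = 0$) is included and counted as zero-sum. Thus $n(S)$ is the number of tuples $(f_1,\dots,f_g)$ with $0 \le f_i \le e_i$ and $\sum_{i=1}^g f_i r_i = 0_G$. *)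

(* Defs.v *)
From mathcomp Require Import all_boot all_order all_algebra all_fingroup cyclic.
From mathcomp Require Import complex.
From mathcomp Require Import boolp classical_sets functions cardinality.
From mathcomp Require Import fsbigop reals.

Set Implicit Arguments.
Unset Strict Implicit.
Unset Printing Implicit Defensive.

Import Order.TTheory GRing.Theory Num.Theory.

Local Open Scope classical_set_scope.
Local Open Scope ring_scope.
Local Open Scope complex_scope.

(* Homomorphisms from the additive group G to the multiplicative group of
   nonzero complex numbers. *)
Definition dual_group (R : realType) (G : finZmodType) :
    set {ffun G -> R[i]} :=
  [set chi | (forall x, chi x != 0) /\
             (forall x y, chi (x + y) = chi x * chi y)].
Arguments dual_group : clear implicits.

(* A sum over an infinite set with infinite support would be 0 by convention;
   this lemma shows that sums over the dual group are genuine. *)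
Lemma finite_dual_group (R : realType) (G : finZmodType) :
  finite_set (dual_group R G).
Proof.
have [s sP] := closed_field_poly_normal ('X^#|G| - 1 : {poly R[i]}).
have G0 : (0 < #|G|)%N by apply/card_gt0P; exists 0.
have lc : lead_coef ('X^#|G| - 1 : {poly R[i]}) = 1.
  by apply/eqP; rewrite -monicE -[1]/(1%:P) monicXnsubC.
rewrite lc scale1r in sP.
pose F (f : {ffun G -> 'I_(size s)}) : {ffun G -> R[i]} :=
  [ffun x => nth 0 s (f x)].
apply: (@sub_finite_set _ _ (F @` setT)); last exact: finite_image.
move=> chi [chi0 chiD].
have chi00 : chi 0 = 1.
  by apply: (mulfI (chi0 0)); rewrite -chiD addr0 mulr1.
have chiX x n : chi (x *+ n) = chi x ^+ n.
  by elim: n => [|n IH]; rewrite ?mulr0n // mulrS chiD IH exprS.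
have chis x : chi x \in s.
  rewrite -root_prod_XsubC -sP /root !hornerE -chiX.
  have -> : x *+ #|G| = 0.
    by rewrite -FinRing.zmodXgE -cardsT; apply: expg_cardG; rewrite inE.
  by rewrite chi00 subrr.
have lts x : (index (chi x) s < size s)%N by rewrite index_mem.
exists [ffun x => Ordinal (lts x)] => //.
by apply/ffunP => x; rewrite !ffunE nth_index.
Qed.

(* The sequence (r_0^{e_0}, ..., r_{g-1}^{e_{g-1}}) is given by r and e; its
   subsequences are the dependent exponent tuples f with 0 <= f_i <= e_i. *)
Definition zero_sum_count (G : finZmodType) (g : nat)
    (r : 'I_g -> G) (e : 'I_g -> nat) : nat :=
  #|[set f : {dffun forall i : 'I_g, 'I_(e i).+1}
      | \sum_(i < g) r i *+ f i == 0]%SET|.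

(* Main.v *)
Require Import Defs.
From mathcomp Require Import all_boot all_order all_algebra.
From mathcomp Require Import fingroup cyclic separable cyclotomic.
From mathcomp Require Import complex.
From mathcomp Require Import boolp classical_sets functions cardinality.
From mathcomp Require Import fsbigop reals.

Import Order.TTheory GRing.Theory Num.Theory.
Local Open Scope ring_scope.
Local Open Scope complex_scope.

(** Expanding the product turns the right-hand side into a sum, over exponent
    tuples f, of (1/h) sum_chi chi (sum_i f_i r_i), so the theorem reduces to
    the orthogonality relation sum_chi chi x = h [x = 0].  That relation follows
    from the fact that characters separate points: the translations of the
    regular representation are commuting matrices of finite order, hence
    simultaneously diagonalizable, and each diagonal position of the
    diagonalized representation is a character. *)

Lemma mulrn_card (G : finZmodType) (x : G) : x *+ #|G| = 0.
Proof. by rewrite -FinRing.zmodXgE -cardsT expg_cardG ?inE. Qed.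

Lemma finZmod_card_gt0 (G : finZmodType) : (0 < #|G|)%N.
Proof. by apply/card_gt0P; exists 0. Qed.

(** The minimal polynomial divides ['X^m - 1], which has simple roots because [m] is nonzero in
    characteristic zero. *)
Lemma diagonalizable_finite_order (C : numClosedFieldType) (n m : nat)
    (A : 'M[C]_n.+1) :
  (0 < m)%N -> A ^+ m = 1 -> diagonalizable A.
Proof.
move=> m_gt0 Am1; have [s] := closed_field_poly_normal ('X^m - 1 : {poly C}).
have -> : lead_coef ('X^m - 1 : {poly C}) = 1.
  by apply/eqP; rewrite -monicE -[1]/(1%:P) monicXnsubC.
rewrite scale1r => sP; apply/diagonalizableP; exists s.
  by rewrite -separable_prod_XsubC -sP separable_Xn_sub_1 ?pnatr_eq0 -?lt0n.
rewrite -sP; apply: mxminpoly_min.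
by rewrite rmorphB rmorph1 rmorphXn /= horner_mx_X Am1 subrr.
Qed.

Lemma prod_sum_dffun (A : comNzRingType) (I : finType) (J : I -> finType)
    (F : forall i, J i -> A) :
  \prod_i \sum_(j : J i) F i j =
  \sum_(f : {dffun forall i, J i}) \prod_i F i (f i).
Proof.
(* Repackaging [F] as finite functions lets [big_tag] turn the dependent inner sums into sums over
   one tagged type, where ordinary distributivity applies. *)
pose P i := [ffun j => F i j].
under eq_bigr => i _ do under eq_bigr => j _ do rewrite -[F i j](ffunE (F i)).
under eq_bigr => i _ do rewrite (big_tag P).
rewrite bigA_distr_big_dep -big_fprod (reindex (@fprod_of_dffun I J)) /=.
  apply: eq_bigr => f _; apply: eq_bigr => i _.
  by rewrite ffunE fprodE.
exact/onW_bij/fprod_of_dffun_bij.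
Qed.

Lemma exchange_fsum_sum (V : nmodType) (I : choiceType) (J : finType)
    (D : set I) (F : I -> J -> V) : finite_set D ->
  \sum_(i \in D) \sum_j F i j = \sum_j \sum_(i \in D) F i j.
Proof.
move=> fin; rewrite fsbig_finite // exchange_big.
by apply: eq_bigr => j _; rewrite fsbig_finite.
Qed.

Section DualGroup.
Variables (R : realType) (G : finZmodType).
Implicit Types (chi psi : {ffun G -> R[i]}) (x y : G).

Lemma dual_group0 chi : dual_group R G chi -> chi 0 = 1.
Proof.
by move=> [chi0 chiD]; apply: (mulfI (chi0 0)); rewrite -chiD addr0 mulr1.
Qed.

Lemma dual_groupX chi x n : dual_group R G chi -> chi (x *+ n) = chi x ^+ n.
Proof.
move=> dchi; elim: n => [|n IH]; first by rewrite dual_group0.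
by rewrite mulrS dchi.2 IH exprS.
Qed.

Lemma dual_group_sum chi (I : finType) (F : I -> G) :
  dual_group R G chi -> chi (\sum_i F i) = \prod_i chi (F i).
Proof.
by move=> dchi; apply: (big_morph chi dchi.2); exact: dual_group0.
Qed.

Lemma dual_group1 : dual_group R G [ffun=> 1].
Proof. by split=> *; rewrite !ffunE ?oner_eq0 ?mulr1. Qed.

Lemma dual_groupM chi psi : dual_group R G chi -> dual_group R G psi ->
  dual_group R G [ffun x => chi x * psi x].
Proof.
move=> [chi0 chiD] [psi0 psiD]; split=> [x|x y]; rewrite !ffunE.
  by rewrite mulf_neq0.
by rewrite chiD psiD mulrACA.
Qed.

Lemma dual_groupV chi : dual_group R G chi ->
  dual_group R G [ffun x => (chi x)^-1].
Proof.
by move=> [chi0 chiD]; split=> [x|x y]; rewrite !ffunE ?invr_eq0 ?chiD ?invfM.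
Qed.

Lemma dual_group_of_mxrep (n : nat) (T : G -> 'M[R[i]]_n) x :
  T 0 = 1%:M -> (forall y z, T (y + z) = T y *m T z) -> T x != 1%:M ->
  exists2 chi, dual_group R G chi & chi x != 1.
Proof.
(* In dimension 0 all matrices are equal, contradicting [Tx]. *)
case: n T => [|n] T T0 TD Tx; first by rewrite [T x]thinmx0 [1%:M]thinmx0 eqxx in Tx.
have TX y m : T (y *+ m) = T y ^+ m.
  by elim: m => [|m IH]; rewrite ?mulr0n // mulrS TD IH exprS.
(* The matrices commute because [G] is abelian, and each has order dividing [#|G|]. *)
have [|P Pu /allP Pdiag] := (codiagonalizableP [seq T y | y <- enum G]).1.
  split=> [_ _ /mapP[y _ ->] /mapP[z _ ->]|_ /mapP[y _ ->]].
    by rewrite /comm_mx -!TD addrC.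
  apply: (@diagonalizable_finite_order _ _ #|G|); first exact: finZmod_card_gt0.
  by rewrite -TX mulrn_card T0.
pose D y := P *m T y *m invmx P.
have Ddiag y i j : i != j -> D y i j = 0.
  by move: i j; apply/(diagonalizable_forP _ Pu)/Pdiag/map_f; rewrite mem_enum.
have DD y z i : D (y + z) i i = D y i i * D z i i.
  have -> : D (y + z) = D y *m D z by rewrite /D TD !mulmxA mulmxKV.
  rewrite mxE (bigD1 i) //= big1 ?addr0 // => j ji.
  by rewrite Ddiag ?mul0r // eq_sym.
have D0 i : D 0 i i = 1 by rewrite /D T0 mulmx1 mulmxV // mxE eqxx.
have [i Dxi] : exists i, D x i i != 1.
  apply/existsP; apply: contraNT Tx; rewrite negb_exists => /forallP Dx.
  have Dx1 : D x = 1%:M.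
    apply/matrixP => i j; rewrite [RHS]mxE; have [->|ij] := eqVneq i j.
      exact/eqP/negbNE/Dx.
    by rewrite Ddiag.
  have -> : T x = invmx P *m D x *m P by rewrite /D !mulmxA mulVmx // mul1mx mulmxKV.
  by rewrite Dx1 mulmx1 mulVmx.
exists [ffun y => D y i i]; last by rewrite ffunE.
split=> [y|y z]; rewrite !ffunE //.
(* A zero at [y] would give a zero at [y - y = 0], where the entry is 1. *)
apply/eqP => Dy0; have /eqP := D0 i.
by rewrite -(subrr y) DD Dy0 mul0r eq_sym oner_eq0.
Qed.

Lemma dual_group_separates x :
  x != 0 -> exists2 chi, dual_group R G chi & chi x != 1.
Proof.
move=> x0.
(* The regular representation: the row of [a] has its only 1 in the column of [a + y]. *)
pose T y : 'M[R[i]]_#|G| := \matrix_(i, j) (enum_val j == enum_val i + y)%:R.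
apply: (@dual_group_of_mxrep _ T).
- by apply/matrixP => i j; rewrite !mxE addr0 (inj_eq enum_val_inj) eq_sym.
- move=> y z; apply/matrixP => i j; rewrite !mxE.
  rewrite (bigD1 (enum_rank (enum_val i + y))) //= !mxE enum_rankK eqxx mul1r.
  rewrite addrA big1 ?addr0 // => k; rewrite !mxE => kiy.
  case: eqP => [e|]; last by rewrite mul0r.
  by rewrite -e enum_valK eqxx in kiy.
(* The entry of [T x] at position (0, 0) is 1 only when [x = 0]. *)
apply: contraNneq x0 => /matrixP/(_ (enum_rank 0) (enum_rank 0))/eqP.
by rewrite !mxE enum_rankK add0r eqxx eqr_nat eqb1 eq_sym.
Qed.

(** Multiplication by a character [psi] with [psi x != 1] permutes the dual group, so the sum is
    fixed by the factor [psi x] and must vanish. *)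
Lemma sum_dual_group_neq0 x : x != 0 -> \sum_(chi \in dual_group R G) chi x = 0.
Proof.
move=> /dual_group_separates[psi dpsi psix]; set s := LHS.
suff /eqP : psi x * s = s.
  by rewrite -{2}[s]mul1r -subr_eq0 -mulrBl mulf_eq0 subr_eq0 (negPf psix) => /eqP.
rewrite [RHS](reindex_fsbig (fun chi : {ffun G -> R[i]} => [ffun y => psi y * chi y])
  (dual_group R G)).
  rewrite mulr_fsumr.
  by apply: eq_fsbigr => chi _; rewrite ffunE.
split=> [chi|chi1 chi2 _ _ /ffunP e|chi dchi].
- exact: dual_groupM.
- by apply/ffunP => y; have := e y; rewrite !ffunE; apply/mulfI/dpsi.1.
(* The preimage of [chi] is [psi^-1 * chi], with the inverse kept as a finite function to match
   [dual_groupM]. *)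
exists [ffun y => [ffun z => (psi z)^-1] y * chi y].
  exact/dual_groupM/dchi/dual_groupV.
by apply/ffunP => y; rewrite !ffunE mulVKf ?dpsi.1.
Qed.

(** The dual argument: translating [G] by [y] with [chi y != 1] multiplies the sum by [chi y]. *)
Lemma sum_character chi : dual_group R G chi ->
  \sum_x chi x = (#|G| * (chi == [ffun=> 1]))%:R.
Proof.
move=> dchi; have [->|chi1] := eqVneq.
  by under eq_bigr do rewrite ffunE; rewrite sumr_const muln1.
have [y chiy] : exists y, chi y != 1.
  apply/existsP; apply: contraNT chi1; rewrite negb_exists => /forallP chi1.
  by apply/eqP/ffunP => y; rewrite ffunE; apply/eqP; have := chi1 y; rewrite negbK.
rewrite muln0; set s := LHS; suff /eqP : chi y * s = s.
  by rewrite -{2}[s]mul1r -subr_eq0 -mulrBl mulf_eq0 subr_eq0 (negPf chiy) => /eqP.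
rewrite [RHS](reindex_inj (addrI y)) mulr_sumr.
by apply: eq_bigr => x _; rewrite dchi.2.
Qed.

(* For x = 0, evaluate the double sum of chi x over all chi and x both ways:
   only the trivial character and only x = 0 contribute. *)
Lemma sum_dual_group x :
  \sum_(chi \in dual_group R G) chi x = (#|G| * (x == 0))%:R.
Proof.
have [->|x0] := eqVneq; last by rewrite muln0 sum_dual_group_neq0.
have fin := finite_dual_group R G.
rewrite muln1; transitivity (\sum_y \sum_(chi \in dual_group R G) chi y).
  rewrite [RHS](bigD1 0) //= [X in _ + X]big1 ?addr0 // => y.
  exact: sum_dual_group_neq0.
rewrite -exchange_fsum_sum //.
rewrite (fsbigD1 [ffun=> 1]) //=; last exact: dual_group1.
rewrite sum_character ?eqxx ?muln1; last exact: dual_group1.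
rewrite fsbig1 ?addr0 // => chi [dchi /eqP chi1].
by rewrite sum_character // (negPf chi1) muln0.
Qed.

End DualGroup.

Theorem theorem2 (R : realType) (G : finZmodType) (h : nat) (hG : #|G| = h)
    (g : nat) (r : 'I_g -> G) (e : 'I_g -> nat) :
  (zero_sum_count r e)%:R =
  h%:R^-1 * \sum_(chi \in dual_group R G)
              \prod_(i < g) \sum_(0 <= k < (e i).+1) chi (r i) ^+ k :> R[i].
Proof.
have fin := finite_dual_group R G.
have h0 : h%:R != 0 :> R[i] by rewrite pnatr_eq0 -lt0n -hG finZmod_card_gt0.
apply: (mulfI h0); rewrite mulVKf //.
(* Summing over [chi] first, orthogonality gives [h] for each zero-sum tuple and 0 otherwise;
   summing over [f] first gives back the product. *)
transitivity (\sum_(chi \in dual_group R G)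
    \sum_(f : {dffun forall i : 'I_g, 'I_(e i).+1}) chi (\sum_(i < g) r i *+ f i)).
  rewrite exchange_fsum_sum //.
  under eq_bigr do rewrite sum_dual_group hG natrM.
  rewrite -mulr_sumr /zero_sum_count -sum1_card natr_sum [in LHS]big_mkcond /=.
  by congr (_ * _); apply: eq_bigr => f _; rewrite inE; case: eqP.
apply: eq_fsbigr => chi /set_mem dchi.
under [RHS]eq_bigr do rewrite big_mkord.
rewrite (@prod_sum_dffun _ _ (fun i => 'I_(e i).+1) (fun i k => chi (r i) ^+ k)).
apply: eq_bigr => f _; rewrite dual_group_sum //.
by apply: eq_bigr => i _; rewrite dual_groupX.
Qed.
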